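(* Let $m\geq 2$ be an integer and let $n\in\mathbb N$ be composite. The following are equivalent: (1) $n$ is an $m$-Carmichael number, i.e. $A^{K_m(n)}=I$ for all $A\in\mathrm{GL}(m,\mathbb Z/n\mathbb Z)$; (2) for every prime $p$ dividing $n$, we have $D_m(p)\mid K_m(n)$.
   Context: For $k\geq1$, $\Phi_k(X)$ denotes the $k$th cyclotomic polynomial. For $n\in\mathbb N$ set $D_m(n)=\prod_{k=1}^m\Phi_k(n)$, $\nabla_m(n)=\prod_{p\mid n}p^{\lceil\log_p m\rceil-1}$ (product over the prime divisors $p$ of $n$), and $K_m(n)=n\,\nabla_m(n)\,D_m(n)$. A composite $n\in\mathbb N$ is called an $m$-Carmichael number if $A^{K_m(n)}=I$ for all $A\in\mathrm{GL}(m,\mathbb Z/n\mathbb Z)$. *)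

(* Defs.v *)
From mathcomp Require Export all_boot all_order all_algebra all_field.

Set Implicit Arguments.
Unset Strict Implicit.
Unset Printing Implicit Defensive.

Import Order.TTheory GRing.Theory Num.Theory.
Local Open Scope ring_scope.

Definition composite (n : nat) : Prop := (1 < n)%N /\ ~~ prime n.

Definition Dcyc (m n : nat) : int := \prod_(1 <= k < m.+1) ('Phi_k).[n%:Z].

(* [up_log p m] is the least e with m <= p ^ e, i.e. the ceiling of log_p m;
   it is at least 1 for m >= 2 and p prime, so [.-1] does not truncate. *)
Definition nabla (m n : nat) : nat :=
  (\prod_(p <- primes n) p ^ (up_log p m).-1)%N.

Definition Kexp (m n : nat) : int := n%:Z * (nabla m n)%:Z * Dcyc m n.

(* The exponent of a matrix power is a [nat]; [Kexp m n] is positive for n >= 2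
   (lemma [Kexp_gt0] below), so the absolute value only changes its type. *)
Definition is_Carmichael (m n : nat) : Prop :=
  composite n /\
  forall A : 'M['Z_n]_m, A \in unitmx -> A ^+ `|Kexp m n|%N = 1%:M.

Lemma Cyclotomic_horner_gt0 (k n : nat) :
  (0 < k)%N -> (1 < n)%N -> 0 < ('Phi_k).[n%:Z].
Proof.
move=> k_gt0 n_gt1; elim/ltn_ind: k k_gt0 => k IHk k_gt0.
have /(congr1 (fun p : {poly int} => p.[n%:Z])) := prod_Cyclotomic k_gt0.
rewrite horner_prod !hornerE (big_rem k) ?divisors_id //=.
set q := \prod_(d <- _) _ => Dq.
have q_gt0 : 0 < q.
  rewrite /q big_seq; apply: prodr_gt0 => d.
  rewrite mem_rem_uniq ?divisors_uniq // !inE => /andP[ndk].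
  rewrite -dvdn_divisors // => d_dv_k.
  have d_gt0 := dvdn_gt0 k_gt0 d_dv_k.
  by apply: IHk; rewrite // ltn_neqAle ndk dvdn_leq.
rewrite -(pmulr_lgt0 _ q_gt0) Dq subr_gt0.
by rewrite exprn_egt1 // -lt0n.
Qed.

Lemma Dcyc_gt0 (m n : nat) : (1 < n)%N -> 0 < Dcyc m n.
Proof.
move=> n_gt1; rewrite /Dcyc big_nat; apply: prodr_gt0 => k /andP[k_gt0 _].
exact: Cyclotomic_horner_gt0.
Qed.

Lemma Kexp_gt0 (m n : nat) : (1 < n)%N -> 0 < Kexp m n.
Proof.
move=> n_gt1; rewrite /Kexp !mulr_gt0 ?Dcyc_gt0 //; first exact: ltnW.
rewrite ltz_nat /nabla big_seq; elim/big_ind: _ => // [x y x0 y0|p].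
  by rewrite muln_gt0 x0.
by rewrite mem_primes => /and3P[/prime_gt0 p_gt0 _ _]; rewrite expn_gt0 p_gt0.
Qed.

(* Main.v *)
From HB Require Import structures.
Require Import Defs.
From mathcomp Require Import all_fingroup all_solvable.

(* Two facts carry the proof.  First, for an integer a > 1 the number
   D_m(a) = prod_(k <= m) Phi_k(a) is the least common multiple of the
   a^k - 1, k <= m: if a prime l divides both Phi_j(a) and Phi_k(a), then
   j / gcd(j, k) and k / gcd(j, k) are powers of l, so the k <= m with
   l | Phi_k(a) form a chain for divisibility and the l-part of D_m(a) already
   divides a^K - 1 for the largest such K.  Second, over F_p the roots of the
   characteristic polynomial of an invertible m x m matrix lie in fields with
   p^k elements, k <= m, hence are killed by D_m(p), so that A^(D_m(p) p^e) = 1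
   as soon as p^e >= m; conversely a companion matrix having a generator of
   F_(p^k)^* as eigenvalue has order divisible by p^k - 1.

   If n is m-Carmichael, such companion matrices lift to GL_m(Z/n) by the
   Chinese remainder theorem, so p^k - 1 divides K_m(n) for all k <= m.  In the
   other direction A^(D_m(p) p^e) = 1 mod p becomes 1 mod p^a after a further
   p^(a-1)-th power; here e = ceil(log_p m) and p^a is the p-part of n, and the
   exponent D_m(p) p^(e+a-1) divides K_m(n) because p is prime to D_m(p). *)

Set Implicit Arguments.
Unset Strict Implicit.
Unset Printing Implicit Defensive.

Import Order.TTheory GRing.Theory Num.Theory.
Local Open Scope ring_scope.

(** * Divisibility among values of cyclotomic polynomials *)

Lemma dvdz_prod_subset (I : eqType) (s1 s2 : seq I) (F : I -> int) :
    uniq s1 -> uniq s2 -> {subset s1 <= s2} ->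
  (\prod_(i <- s1) F i %| \prod_(i <- s2) F i)%Z.
Proof.
move=> Us1 Us2 s12; rewrite [X in (_ %| X)%Z](bigID (mem s1)) /=.
rewrite -[X in (_ %| X * _)%Z]big_filter.
rewrite [X in (_ %| X * _)%Z](perm_big s1) ?dvdz_mulr //.
apply: uniq_perm => [||i]; rewrite ?filter_uniq // mem_filter.
by case: (boolP (i \in s1)) => // /s12->.
Qed.

Lemma dvdz_geometric_sum (x l : int) r :
  (l %| x - 1)%Z -> (l %| \sum_(i < r) x ^+ i)%Z = (l %| r%:Z)%Z.
Proof.
move=> l_dvd; rewrite -[RHS](rpredDr _ _ (x := \sum_(i < r) (x ^+ i - 1))).
  by rewrite sumrB sumr_const card_ord -natz addrC subrK.
apply: rpred_sum => i _; rewrite subrX1; exact: dvdz_mulr.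
Qed.

Section CyclotomicValues.

Variable a : nat.
Hypothesis a_gt1 : (1 < a)%N.

Local Notation Phi k := (('Phi_k).[a%:Z]).

Lemma prod_Cyclotomic_horner k : (0 < k)%N ->
  \prod_(d <- divisors k) Phi d = a%:Z ^+ k - 1.
Proof. by move=> k_gt0; rewrite -horner_prod prod_Cyclotomic // !hornerE. Qed.

Lemma prod_Cyclotomic_horner_dvd d k : (0 < k)%N -> (d %| k)%N ->
  \prod_(e <- divisors k | (e %| d)%N) Phi e = a%:Z ^+ d - 1.
Proof.
move=> k_gt0 dvd_dk; have d_gt0 := dvdn_gt0 k_gt0 dvd_dk.
rewrite -prod_Cyclotomic_horner // -big_filter; apply: perm_big.
apply: uniq_perm => [||e]; rewrite ?filter_uniq ?divisors_uniq //.
rewrite mem_filter -!dvdn_divisors //.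
by case: (boolP (e %| d)%N) => // /dvdn_trans->.
Qed.

Lemma expz_sub1_neq0 k : (0 < k)%N -> a%:Z ^+ k - 1 != 0.
Proof. by move=> k0; rewrite subr_eq0 gt_eqF // exprn_egt1 // -lt0n. Qed.

Lemma Cyclotomic_horner_dvd_sub1 k : (0 < k)%N ->
  (Phi k %| a%:Z ^+ k - 1)%Z.
Proof.
move=> k_gt0; rewrite -prod_Cyclotomic_horner //.
by rewrite (big_rem k) ?divisors_id //= dvdz_mulr.
Qed.

(** The sum is [(a ^ (d * r) - 1) / (a ^ d - 1)], the product of the [Phi e] over the divisors [e]
    of [d * r] that do not divide [d]; as [r > 1], [d * r] is one of them. *)
Lemma Cyclotomic_horner_dvd_sum d r : (0 < d)%N -> (1 < r)%N ->
  (Phi (d * r) %| \sum_(i < r) (a%:Z ^+ d) ^+ i)%Z.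
Proof.
move=> d_gt0 r_gt1; have r_gt0 := ltnW r_gt1.
have dr_gt0 : (0 < d * r)%N by rewrite muln_gt0 d_gt0.
have := prod_Cyclotomic_horner dr_gt0.
rewrite (bigID (fun e => (e %| d)%N)) /=.
rewrite prod_Cyclotomic_horner_dvd ?dvdn_mulr // exprM (subrX1 (_ ^+ d)).
move/(mulfI (expz_sub1_neq0 d_gt0)) => <-.
rewrite -big_filter (big_rem (d * r)%N) /= ?dvdz_mulr //.
rewrite mem_filter divisors_id // andbT.
by apply/negP => /(dvdn_leq d_gt0); rewrite leqNgt ltn_Pmulr.
Qed.

(** Let [r] be the [l']-part of [s]. If [r > 1], then [Phi (g * s)] divides a sum of [r] powers of
    [a ^ (g * s_l)]. Each is 1 modulo [l], so [l] would divide [r]. *)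
Lemma Cyclotomic_horner_dvd_pnat (l g s : nat) :
    prime l -> (0 < g)%N -> (0 < s)%N ->
  (l %| Phi (g * s))%Z -> (l %| a%:Z ^+ g - 1)%Z -> l.-nat s.
Proof.
move=> l_pr g_gt0 s_gt0 l_Phi l_g; have Ds := partnC l s_gt0.
have [r_le1 | r_gt1] := leqP (s`_l^') 1.
  have r1: (s`_l^' = 1)%N by apply/eqP; rewrite eqn_leq r_le1 part_gt0.
  by rewrite -Ds r1 muln1 part_pnat.
have gc_gt0 : (0 < g * s`_l)%N by rewrite muln_gt0 g_gt0 part_gt0.
move: (Cyclotomic_horner_dvd_sum gc_gt0 r_gt1).
rewrite -mulnA Ds => /(dvdz_trans l_Phi).
rewrite dvdz_geometric_sum; last first.
  by rewrite exprM subrX1 dvdz_mulr.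
rewrite dvdzE /= => l_r.
have : l \in l^' by apply: (pnatP _ (part_gt0 l^' s) (part_pnat l^' s)).
by rewrite !inE eqxx.
Qed.

Lemma dvdz_expz_sub1_gcd (l j k : nat) : (0 < j)%N ->
  (l %| a%:Z ^+ j - 1)%Z -> (l %| a%:Z ^+ k - 1)%Z ->
  (l %| a%:Z ^+ (gcdn j k) - 1)%Z.
Proof.
move=> j_gt0 lj lk; have [u v Duv _] := egcdnP k j_gt0.
have l_mul b c : (l %| a%:Z ^+ b - 1)%Z -> (l %| a%:Z ^+ (c * b) - 1)%Z.
  by move=> lb; rewrite mulnC exprM subrX1 dvdz_mulr.
have := l_mul _ u lj; rewrite Duv exprD => lu.
rewrite -(rpredDr _ (dvdz_mulr (a%:Z ^+ gcdn j k) (l_mul _ v lk))).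
by rewrite mulrBl mul1r addrC addrA subrK.
Qed.

Lemma Cyclotomic_horner_common_prime (l j k : nat) :
    prime l -> (0 < j)%N -> (j <= k)%N ->
  (l %| Phi j)%Z -> (l %| Phi k)%Z -> (j %| k)%N.
Proof.
move=> l_pr j_gt0 le_jk lj lk; have k_gt0 := leq_trans j_gt0 le_jk.
set g := gcdn j k; have g_gt0 : (0 < g)%N by rewrite gcdn_gt0 j_gt0.
have lg : (l %| a%:Z ^+ g - 1)%Z.
  by apply: dvdz_expz_sub1_gcd => //;
    apply: dvdz_trans (Cyclotomic_horner_dvd_sub1 _).
have pow i : (0 < i)%N -> (g %| i)%N -> (l %| Phi i)%Z ->
    exists e, i = (l ^ e * g)%N.
  move=> i_gt0 /dvdnP[s Di] li.
  have s_gt0 : (0 < s)%N by case: s Di i_gt0 => // ->.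
  have : l.-nat s.
    by apply: (@Cyclotomic_horner_dvd_pnat l g) => //; rewrite mulnC -Di.
  by case/p_natP=> // e De; exists e; rewrite Di De.
have [e Dj] := pow j j_gt0 (dvdn_gcdl _ _) lj.
have [f Dk] := pow k k_gt0 (dvdn_gcdr _ _) lk.
move: le_jk; rewrite Dj Dk leq_pmul2r // leq_exp2l ?prime_gt1 // => le_ef.
by rewrite dvdn_pmul2r // dvdn_exp2l.
Qed.

Lemma expz_sub1_dvd_Dcyc m k : (0 < k <= m)%N ->
  (a%:Z ^+ k - 1 %| Dcyc m a)%Z.
Proof.
case/andP=> k_gt0 le_km; rewrite -prod_Cyclotomic_horner //.
apply: dvdz_prod_subset; rewrite ?divisors_uniq ?iota_uniq // => d.
rewrite -dvdn_divisors // mem_index_iota ltnS => dvd_dk.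
by rewrite (dvdn_gt0 k_gt0) // (leq_trans _ le_km) // dvdn_leq.
Qed.

Lemma Dcyc_dvd m (N : int) :
  (forall k, (0 < k <= m)%N -> (a%:Z ^+ k - 1 %| N)%Z) -> (Dcyc m a %| N)%Z.
Proof.
move=> dvdN; rewrite dvdzE; apply/dvdn_partP => [|l].
  by rewrite absz_gt0 gt_eqF // Dcyc_gt0.
rewrite mem_primes => /and3P[l_pr _ _].
(* [P1] collects the factors divisible by [l]. The product [P2] of the others is prime to [l], so
   [P1] carries the whole [l]-part. *)
rewrite /Dcyc (bigID (fun k => (l %| Phi k)%Z)) /=.
set P1 := \prod_(_ <= k < _ | _) _; set P2 := \prod_(_ <= k < _ | _) _.
have P1_gt0 : 0 < P1.
  rewrite /P1 big_nat_cond; apply: prodr_gt0 => k /andP[/andP[k_gt0 _] _].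
  exact: Cyclotomic_horner_gt0.
have P2_gt0 : 0 < P2.
  rewrite /P2 big_nat_cond; apply: prodr_gt0 => k /andP[/andP[k_gt0 _] _].
  exact: Cyclotomic_horner_gt0.
have l'P2 : ~~ (l %| P2)%Z.
  rewrite /P2; apply: (big_ind (fun x : int => ~~ (l %| x)%Z)) => // [|x y].
    by rewrite dvdzE /= dvdn1 gtn_eqF ?prime_gt1.
  by rewrite !dvdzE abszM Euclid_dvdM // => /negPf-> /negPf->.
rewrite abszM partnM ?absz_gt0 ?gt_eqF // (@part_p'nat _ `|P2|%N); last first.
  by rewrite p'natE.
rewrite muln1; apply: dvdn_trans (dvdn_part _ _) _.
rewrite -(@dvdzE P1 N).
pose Q k := (0 < k <= m)%N && (l %| Phi k)%Z.
have Qm k : Q k -> (k <= m)%N by case/andP=> /andP[].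
(* With [K] the largest index in [P1], all indices in [P1] divide [K], so [P1] is a subproduct of
   [a ^ K - 1]. *)
have [exQ|noQ] := boolP (has Q (iota 0 m.+1)).
  have {}exQ : exists k, Q k by case/hasP: exQ => k _ Qk; exists k.
  case: (ex_maxnP exQ Qm) => K /andP[K_m l_K] maxK.
  apply: dvdz_trans (dvdN K K_m); have [K_gt0 _] := andP K_m.
  rewrite -prod_Cyclotomic_horner // -[P1]big_filter.
  apply: dvdz_prod_subset => [||k];
    rewrite ?filter_uniq ?divisors_uniq ?iota_uniq //.
  rewrite mem_filter mem_index_iota ltnS => /andP[l_k k_m].
  rewrite -dvdn_divisors //; have [k_gt0 _] := andP k_m.
  apply: (@Cyclotomic_horner_common_prime l) => //.
  by rewrite maxK // /Q k_m.
rewrite /P1 big_nat_cond big_pred0 ?dvd1z // => k; apply/negP => Qk.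
by case/hasP: noQ; exists k; rewrite // mem_iota; case/andP: Qk => /andP[].
Qed.

End CyclotomicValues.

(** * Orders of invertible matrices over finite fields *)

(** The minimal polynomial of [z] divides [P], so [z] lies in an extension of degree [k <= m] and is
    killed by [#|F| ^ k - 1]. *)
Lemma root_map_poly_expr (F : finFieldType) (L : fieldExtType F) (z : L)
    (P : {poly F}) (m N : nat) :
    P != 0 -> (size P <= m.+1)%N -> z != 0 -> root (map_poly (in_alg L) P) z ->
    (forall k, 0 < k <= m -> #|F| ^ k - 1 %| N)%N ->
  z ^+ N = 1.
Proof.
move=> P_nz szP z_nz Pz dvdN; pose K := <<1; z>>%AS.
have le_deg : (\dim K <= m)%N.
  rewrite dim_Fadjoin dimv1 muln1 -ltnS -size_minPoly.
  apply: leq_trans szP; rewrite -(size_map_poly (in_alg L)).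
  apply: dvdp_leq; first by rewrite map_poly_eq0.
  by apply: minPoly_dvdp => //; apply/polyOver1P; exists P.
have /dvdnP[c ->] : (#|F| ^ \dim K - 1 %| N)%N by rewrite dvdN // adim_gt0.
rewrite mulnC exprM.
suffices -> : z ^+ (#|F| ^ \dim K - 1) = 1 by rewrite expr1n.
have := memv_adjoin 1 z; rewrite (Fermat's_little_theorem K) => /eqP zq.
apply: (mulIf z_nz); rewrite mul1r -exprSr subn1 prednK // expn_gt0.
by rewrite (cardD1 0) inE.
Qed.

Lemma unitmx_expr_finField (F : finFieldType) (p m N e : nat)
    (A : 'M[F]_m) :
    p \in [pchar F] -> A \in unitmx -> (m <= p ^ e)%N ->
    (forall k, 0 < k <= m -> #|F| ^ k - 1 %| N)%N ->
  A ^+ (N * p ^ e) = 1.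
Proof.
case: m A => [|m] A; first by rewrite [LHS]flatmx0 [RHS]flatmx0.
move=> pcharFp uA le_mpe dvdN; set P := char_poly A.
have P_nz : P != 0 by rewrite monic_neq0 ?char_poly_monic.
have [L [zs DP _]] := FinSplittingFieldFor P_nz.
have szP : size P = m.+2 by rewrite size_char_poly.
have szs : size zs = m.+1.
  have := eqp_size DP; rewrite size_map_poly szP size_prod_XsubC.
  by case.
have zsN : {in zs, forall z, z ^+ N = 1}.
  move=> z zs_z; have Pz : root (map_poly (in_alg L) P) z.
    by rewrite (eqp_root DP) root_prod_XsubC.
  apply: (@root_map_poly_expr F L z P m.+1) => //; first by rewrite szP.
  (* Zero is not a root: the constant coefficient of [P] is the determinant up to sign. *)
  apply: contraL Pz => /eqP->; rewrite /root horner_coef0 coef_map /=.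
  rewrite char_poly_det scaler_eq0 oner_eq0 orbF mulf_eq0 signr_eq0 /=.
  by move: uA; rewrite unitmxE unitfE.
(* All [m.+1] roots of [P] are roots of ['X^N - 1], so its power [m.+1] absorbs any multiplicities.
   With exponent [p ^ e] instead, Frobenius turns the power into ['X^(N * p ^ e) - 1], and
   Cayley-Hamilton applies. *)
have dvdP : P %| ('X^N - 1) ^+ (p ^ e).
  rewrite -(dvdp_map (in_alg L)) (eqp_dvdl _ DP).
  rewrite rmorphXn rmorphB /= map_polyXn rmorph1.
  apply: (@dvdp_trans _ (('X^N - 1) ^+ m.+1)); last exact: dvdp_exp2l.
  rewrite -szs; elim: zs zsN {DP szs} => [|z zs IHzs] zsN.
    by rewrite big_nil dvd1p.
  rewrite big_cons exprS dvdp_mul ?IHzs // => [|x x_zs].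
    by rewrite dvdp_XsubCl /root !hornerE zsN ?subrr ?mem_head.
  by rewrite zsN // inE x_zs orbT.
have pcharP : p \in [pchar {poly F}] by rewrite pchar_poly.
have pn : [pchar {poly F}].-nat (p ^ e)%N.
  by rewrite pnatX pnatE ?(pcharf_prime pcharFp) // pcharP.
have := dvdP; rewrite exprDn_pchar // exprNn_pchar // expr1n -exprM.
case/dvdpP=> Q DQ.
have := congr1 (horner_mx A) DQ.
rewrite rmorphM /= Cayley_Hamilton mulr0 rmorphB rmorphXn /= horner_mx_X.
by rewrite rmorph1 => /eqP; rewrite subr_eq0 => /eqP.
Qed.

Lemma eigenvalue_expr1 (F : fieldType) (m N : nat) (A : 'M[F]_m) (z : F) :
  eigenvalue A z -> A ^+ N = 1 -> z ^+ N = 1.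
Proof.
case/eigenvalueP=> v vA v_nz AN.
have vAN : v *m A ^+ N = z ^+ N *: v.
  elim: (N) => [|i IHi]; first by rewrite !expr0 scale1r mulmx1.
  by rewrite exprSr mulmxA IHi -scalemxAl vA scalerA -exprSr.
apply/eqP; rewrite -subr_eq0; move: vAN; rewrite AN mulmx1 => /eqP.
rewrite -subr_eq0 -{1}[v]scale1r -scalerBl scalemx_eq0 (negPf v_nz) orbF.
by rewrite -opprB oppr_eq0.
Qed.

Lemma unitmx_with_eigenvalue (F L : fieldType) (f : {rmorphism F -> L})
    (P : {poly F}) (m : nat) (z : L) :
    P \is monic -> P`_0 != 0 -> size P = m.+1 -> root (map_poly f P) z ->
  exists2 B : 'M[F]_m, B \in unitmx & forall N, B ^+ N = 1 -> z ^+ N = 1.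
Proof.
move=> monP P0 szP Pz; have -> : m = (size P).-1 by rewrite szP.
exists (companionmx P) => [|N BN].
  rewrite unitmxE unitfE; apply: contra P0 => /eqP detB.
  by rewrite -[P]companionmxK // char_poly_det detB mulr0.
apply: (@eigenvalue_expr1 _ _ _ (map_mx f (companionmx P))).
  by rewrite eigenvalue_root_char -map_char_poly companionmxK.
by rewrite -rmorphXn BN rmorph1.
Qed.

Lemma finField_generator (F : finFieldType) :
  exists2 z : F, z != 0 & forall N, z ^+ N = 1 -> (#|F|.-1 %| N)%N.
Proof.
have /cyclicP[x Dx] := field_unit_group_cyclic [set: {unit F}].
exists (val x) => [|N xN]; first by rewrite -unitfE (valP x).
rewrite -card_finField_unit Dx -orderE order_dvdn.
by apply/eqP/val_inj; rewrite /= FinRing.val_unitX.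
Qed.

(** Otherwise [Q = R * 'X], and the nonzero [z] would be a root of [R], whose degree is too
    small. *)
Lemma minPoly_coef0_neq0 (F : fieldType) (L : fieldExtType F) (z : L)
    (Q : {poly F}) :
  z != 0 -> minPoly 1 z = map_poly (in_alg L) Q -> Q`_0 != 0.
Proof.
move=> z_nz DQ; have Q_nz : Q != 0.
  rewrite -(map_poly_eq0 (in_alg L)) -DQ; exact: monic_neq0 (monic_minPoly _ _).
apply/negP => Q0; have /factor_theorem[R DR] : root Q 0.
  by rewrite /root horner_coef0.
rewrite subr0 in DR; have R_nz : R != 0.
  by apply: contraNneq Q_nz => R0; rewrite DR R0 mul0r.
have := minPolyxx 1 z; rewrite DQ DR rmorphM /= map_polyX hornerM hornerX.
move/eqP; rewrite mulf_eq0 (negPf z_nz) orbF => Rz.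
have := @root_small_adjoin_poly _ _ 1%AS z (map_poly (in_alg L) R).
rewrite /root Rz map_poly_eq0 (negPf R_nz) => {Rz} absurd.
suffices : true = false by []; apply: absurd.
  by apply/polyOver1P; exists R.
by rewrite -ltnS -size_minPoly DQ !size_map_poly DR size_mulX.
Qed.

Lemma unitmx_Fp_large_order (p k m : nat) : prime p -> (0 < k <= m)%N ->
  exists2 B : 'M['F_p]_m, B \in unitmx &
    forall N, B ^+ N = 1 -> (p ^ k - 1 %| N)%N.
Proof.
move=> p_pr /andP[k_gt0 le_km].
have [K pcharK cardK] := pPrimePowerField p_pr k_gt0.
have [z z_nz ord_z] := finField_generator K.
pose L : fieldExtType 'F_p := pPrimeCharType pcharK.
have dimL : \dim {:L} = k.
  by rewrite pprimeChar_dimf cardK pfactorK.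
have /polyOver1P[Q DQ] : minPoly 1 (z : L) \is a polyOver 1%VS.
  exact: (minPolyOver 1%AS).
have Q0 := @minPoly_coef0_neq0 _ L z Q z_nz DQ.
have monQ : Q \is monic.
  by rewrite -(map_monic (in_alg L)) -DQ monic_minPoly.
have szQ : (size Q <= m.+1)%N.
  rewrite -(size_map_poly (in_alg L)) -DQ size_minPoly ltnS.
  apply: leq_trans le_km; rewrite -dimL.
  have := dimvS (subvf <<1; (z : L)>>%VS).
  by rewrite dim_Fadjoin dimv1 muln1.
(* The power of ['X - 1] raises the degree to exactly [m] and keeps the constant coefficient
   nonzero. *)
pose P := Q * ('X - 1%:P) ^+ (m.+1 - size Q).
have monP : P \is monic by rewrite rpredM ?monic_exp ?monicXsubC.
have [||| B uB ordB] := @unitmx_with_eigenvalue _ _ (in_alg L) P m (z : L) monP.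
- rewrite -horner_coef0 hornerM horner_exp !hornerE mulf_neq0 ?horner_coef0 //.
  by rewrite signr_eq0.
- rewrite size_monicM ?monic_neq0 ?monic_exp ?monicXsubC //.
  by rewrite size_exp_XsubC addnS /= subnKC.
- by rewrite rmorphM /= -DQ rootM root_minPoly.
by exists B => // N /ordB/ord_z; rewrite cardK subn1.
Qed.

(** * Reduction from Z/n to F_p, and lifting back *)

Definition red_Zp (n p : nat) (x : 'Z_n) : 'F_p := (x : nat)%:R.
Arguments red_Zp : clear implicits.

Section Reduction.

Variables n p : nat.
Hypotheses (n_gt1 : (1 < n)%N) (p_pr : prime p) (p_dvd_n : (p %| n)%N).

Lemma red_Zp_nat k : red_Zp n p k%:R = k%:R.
Proof.
rewrite /red_Zp val_Zp_nat // -(Fp_nat_mod p_pr) modn_dvdm //.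
by rewrite Fp_nat_mod.
Qed.

Lemma red_Zp_zmod_morphism : zmod_morphism (red_Zp n p).
Proof.
move=> x y; apply: (addIr (red_Zp n p y)); rewrite subrK.
rewrite -{2}[y]natr_Zp -{1}[x - y]natr_Zp !red_Zp_nat -natrD -red_Zp_nat.
by rewrite natrD !natr_Zp subrK.
Qed.

Lemma red_Zp_monoid_morphism : monoid_morphism (red_Zp n p).
Proof.
split; first exact: (red_Zp_nat 1).
move=> x y; rewrite -{1}[x]natr_Zp -{1}[y]natr_Zp -natrM.
by rewrite red_Zp_nat natrM.
Qed.

Lemma red_Zp_eq0 (x : 'Z_n) : (red_Zp n p x == 0) = (p %| x)%N.
Proof. by rewrite /red_Zp -(dvdn_pcharf (pchar_Fp p_pr)). Qed.

End Reduction.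

(** The ring laws rest on these hypotheses, so the structure is packed as a term taking them as
    arguments. *)
Definition red_Zp_rmorphism n p (n_gt1 : (1 < n)%N) (p_pr : prime p)
    (p_dvd_n : (p %| n)%N) : {rmorphism 'Z_n -> 'F_p} :=
  HB.pack (red_Zp n p)
    (GRing.isZmodMorphism.Build _ _ _ (red_Zp_zmod_morphism n_gt1 p_pr p_dvd_n))
    (GRing.isMonoidMorphism.Build _ _ _
      (red_Zp_monoid_morphism n_gt1 p_pr p_dvd_n)).

Lemma unit_Zp_red n (x : 'Z_n) : (1 < n)%N ->
  (forall p, prime p -> (p %| n)%N -> red_Zp n p x != 0) ->
  x \is a GRing.unit.
Proof.
move=> n_gt1 red_x; rewrite -[x]natr_Zp unitZpE //.
rewrite /coprime eqn_leq gcdn_gt0 (ltnW n_gt1) andbT leqNgt.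
apply/negP => /pdivP[p p_pr]; rewrite dvdn_gcd => /andP[p_n p_x].
by have := red_x p p_pr p_n; rewrite red_Zp_eq0 // p_x.
Qed.

Lemma unitmx_Zp_red n m (A : 'M['Z_n]_m) : (1 < n)%N ->
    (forall p, prime p -> (p %| n)%N -> map_mx (red_Zp n p) A \in unitmx) ->
  A \in unitmx.
Proof.
move=> n_gt1 redA; rewrite unitmxE; apply: unit_Zp_red => // p p_pr p_n.
have := redA p p_pr p_n; rewrite unitmxE unitfE.
by rewrite (det_map_mx (red_Zp_rmorphism n_gt1 p_pr p_n)).
Qed.

Lemma unitmx_Fp_lift n p m (B : 'M['F_p]_m) :
    (1 < n)%N -> prime p -> (p %| n)%N -> B \in unitmx ->
  exists2 A : 'M['Z_n]_m, A \in unitmx & map_mx (red_Zp n p) A = B.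
Proof.
move=> n_gt1 p_pr p_n uB; have n_gt0 := ltnW n_gt1.
(* Entries agree with [B] modulo the [p]-part of [n] and with the identity modulo the rest, so the
   lift is invertible modulo every prime divisor of [n]. *)
pose a i j := chinese n`_p n`_p^' (B i j) (i == j).
have co_n : coprime n`_p n`_p^' by apply: coprime_partC.
pose A : 'M['Z_n]_m := \matrix_(i, j) (a i j)%:R.
have redA : map_mx (red_Zp n p) A = B.
  apply/matrixP=> i j; rewrite !mxE red_Zp_nat // -[RHS]natr_Zp.
  rewrite -(Fp_nat_mod p_pr) -[RHS](Fp_nat_mod p_pr).
  have p_np : (p %| n`_p)%N.
    by rewrite -{1}(part_pnat_id (pnat_id p_pr)) partn_dvd.
  by rewrite -(modn_dvdm _ p_np) chinese_modl // modn_dvdm.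
exists A => //; apply: unitmx_Zp_red => // l l_pr l_n.
have [->|l_neq_p] := eqVneq l p; first by rewrite redA.
suffices -> : map_mx (red_Zp n l) A = 1%:M by rewrite unitmx1.
apply/matrixP=> i j; rewrite !mxE red_Zp_nat //.
rewrite -(Fp_nat_mod l_pr) -[RHS](Fp_nat_mod l_pr).
have l_np : (l %| n`_p^')%N.
  rewrite -{1}(part_pnat_id (_ : p^'.-nat l)) ?partn_dvd //.
  by rewrite pnatE // !inE.
by rewrite -(modn_dvdm _ l_np) chinese_modr // modn_dvdm.
Qed.

(** * From congruences modulo p to prime powers *)

Lemma expr_mulrn_sub1 (S : pzRingType) (x y : S) (c s : nat) :
  x - 1 = y *+ c -> exists z, x ^+ s - 1 = z *+ c.
Proof.
move=> Dx; exists (y * \sum_(i < s) x ^+ i).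
by rewrite subrX1 Dx mulrnAl.
Qed.

Lemma expr_expn_sub1 (S : pzRingType) (x y : S) (p j : nat) :
  x - 1 = y *+ p -> exists z, x ^+ (p ^ j) - 1 = z *+ (p ^ j.+1).
Proof.
move=> Dx; elim: j => [|j [z Dz]]; first by exists y.
rewrite expnSr exprM; set w := x ^+ _ in Dz *.
(* Since [w] is 1 modulo [p], the sum is [r] modulo [p]; taking [r = p] makes it a multiple of [p],
   which gains one factor [p] in [w ^+ p - 1]. *)
have sum_w r : exists v, \sum_(i < r) w ^+ i = r%:R + v *+ p.
  elim: r => [|r [v Dv]]; first by exists 0; rewrite big_ord0 mul0rn addr0.
  have [u Du] := expr_mulrn_sub1 r Dz.
  exists (v + u *+ p ^ j); rewrite big_ord_recr /= Dv.
  rewrite -[w ^+ r](subrK 1) Du mulrnDl -mulrnA -expnSr -natr1.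
  by rewrite [X in _ + X]addrC addrACA.
have [v Dv] := sum_w p; exists (z * (1 + v)).
by rewrite subrX1 Dz Dv mulrnAl -mulrnDl mulrnAr -mulrnA -expnS.
Qed.

Lemma red_Zp_mx1 n p m (M : 'M['Z_n]_m) :
    (1 < n)%N -> prime p -> (p %| n)%N -> map_mx (red_Zp n p) M = 1 ->
  exists N, M - 1 = N *+ p.
Proof.
move=> n_gt1 p_pr p_n redM; pose C : 'M['Z_n]_m := M - 1.
exists (\matrix_(i, j) (C i j %/ p)%N%:R).
apply/matrixP=> i j; rewrite mulmxnE [in RHS]mxE -mulrnA divnK ?natr_Zp //.
rewrite -(red_Zp_eq0 p_pr).
have /matrixP/(_ i j) := map_mxB (red_Zp_rmorphism n_gt1 p_pr p_n) M 1%:M.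
by rewrite map_mx1 [map_mx _ M]redM subrr !mxE /= => ->.
Qed.

(** Each factor divides some [p ^ k - 1] with [k > 0], which is -1 modulo [p]. *)
Lemma coprime_Dcyc p m : prime p -> coprime p `|Dcyc m p|%N.
Proof.
move=> p_pr; have p_gt1 := prime_gt1 p_pr; rewrite prime_coprime //.
rewrite -[p in (p %| _)%N]/(`|p%:Z|%N) -dvdzE /Dcyc big_nat.
apply: (big_ind (fun x : int => ~~ (p %| x)%Z)) => [|x y|k /andP[k_gt0 _]].
- by rewrite dvdzE /= dvdn1 gtn_eqF.
- by rewrite !dvdzE abszM Euclid_dvdM // => /negPf-> /negPf->.
apply/negP=> /dvdz_trans/(_ (Cyclotomic_horner_dvd_sub1 p k_gt0)).
rewrite -(rpredBl _ (x := p%:Z ^+ k)); last first.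
  by rewrite -(prednK k_gt0) exprS dvdz_mulr.
by rewrite opprB addrC subrK dvdzE /= dvdn1 gtn_eqF.
Qed.

Lemma expn_dvd_nabla m n p : prime p -> (p %| n)%N -> (0 < n)%N ->
  (p ^ (up_log p m).-1 %| nabla m n)%N.
Proof.
move=> p_pr p_n n_gt0; rewrite /nabla (big_rem p) /= ?dvdn_mulr //.
by rewrite mem_primes p_pr n_gt0.
Qed.

Lemma absz_expn_sub1 a k : (0 < a)%N -> `|a%:Z ^+ k - 1|%N = (a ^ k - 1)%N.
Proof.
move=> a_gt0; rewrite -[a%:Z]natz -natrX natz.
by rewrite subzn // expn_gt0 a_gt0.
Qed.

Theorem theorem2p8 (m n : nat) (hm : (2 <= m)%N) (hn : composite n) :
  is_Carmichael m n <->
  (forall p : nat, prime p -> (p %| n)%N -> (Dcyc m p %| Kexp m n)%Z).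
Proof.
have n_gt1 : (1 < n)%N by case: hn.
have n_gt0 := ltnW n_gt1.
split=> [[_ carm] p p_pr p_n | dvdK].
  have p_gt1 := prime_gt1 p_pr.
  apply: Dcyc_dvd => // k k_m.
  have [B uB ordB] := unitmx_Fp_large_order p_pr k_m.
  have [A uA redA] := unitmx_Fp_lift n_gt1 p_pr p_n uB.
  rewrite dvdzE absz_expn_sub1 ?prime_gt0 //; apply: ordB; rewrite -redA.
  rewrite -(rmorphXn (map_mx (red_Zp_rmorphism n_gt1 p_pr p_n))) carm //.
  exact: (map_mx1 (red_Zp_rmorphism n_gt1 p_pr p_n)).
split=> // A uA; set K := `|_|%N.
have part_K p : prime p -> (p %| n)%N ->
    exists N : 'M['Z_n]_m, A ^+ K - 1 = N *+ (n`_p)%N.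
  move=> p_pr p_n; have p_gt1 := prime_gt1 p_pr; have p_gt0 := prime_gt0 p_pr.
  set D := `|Dcyc m p|%N; set e := up_log p m.
  have e_gt0 : (0 < e)%N by rewrite up_log_gt0 p_gt1.
  have [a Da] : exists a, (n`_p = p ^ a.+1)%N.
    exists (logn p n).-1; rewrite p_part prednK //.
    by rewrite logn_gt0 mem_primes p_pr n_gt0.
  have red1 : map_mx (red_Zp n p) (A ^+ (D * p ^ e)) = 1.
    rewrite (rmorphXn (map_mx (red_Zp_rmorphism n_gt1 p_pr p_n))) /=.
    have uB : map_mx (red_Zp n p) A \in unitmx.
      rewrite unitmxE (det_map_mx (red_Zp_rmorphism n_gt1 p_pr p_n)).
      by rewrite rmorph_unit // -unitmxE.
    move: (map_mx _ A) uB (up_logP m p_gt1) => B uB le_m.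
    have dvdD k : (0 < k <= m)%N -> (#|'F_p| ^ k - 1 %| D)%N.
      move=> k_m; rewrite card_Fp // -absz_expn_sub1 // -(@dvdzE _ (Dcyc m p)).
      exact: expz_sub1_dvd_Dcyc.
    exact: (unitmx_expr_finField (pchar_Fp p_pr)).
  have [N DN] := red_Zp_mx1 n_gt1 p_pr p_n red1.
  have [N' DN'] := expr_expn_sub1 a DN.
  have /dvdnP[s ->] : (D * p ^ e * p ^ a %| K)%N.
    rewrite -mulnA -expnD Gauss_dvd; last first.
      by rewrite coprime_sym coprimeXl // coprime_Dcyc.
    rewrite -(@dvdzE _ (Kexp m n)) dvdK //= /K /Kexp !abszM /= dvdn_mulr //.
    (* Split [e + a] as [(e - 1) + (a + 1)]: the first power of [p] divides [nabla m n], the second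
       is the [p]-part of [n]. *)
    rewrite -(prednK e_gt0) addSnnS addnC expnD dvdn_mul ?expn_dvd_nabla //.
    by rewrite -Da dvdn_part.
  rewrite mulnC exprM Da.
  by apply: (expr_mulrn_sub1 s (y := N')); rewrite exprM.
apply/eqP; rewrite -subr_eq0; apply/eqP/matrixP=> i j.
set C := _ - _; rewrite [RHS]mxE.
(* An entry whose representative is divisible by every [p]-part of [n] is divisible by [n], hence
   zero. *)
have : (n %| C i j)%N.
  apply/dvdn_partP => // p; rewrite mem_primes => /and3P[p_pr _ p_n].
  rewrite /C; have [N ->] := part_K p p_pr p_n.
  rewrite mulmxnE Zp_mulrn /=; move: (nat_of_ord (N i j)) => x.
  rewrite Zp_cast // /dvdn modn_dvdm ?dvdn_part //.
  by rewrite modnMl.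
have lt_n : (C i j < n)%N by rewrite -[X in (_ < X)%N](Zp_cast n_gt1) ltn_ord.
by rewrite /dvdn modn_small // => /eqP Cij0; apply/val_inj.
Qed.
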